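(* For all sufficiently large $n$, the threshold bias for the connected Maker-Breaker odd cycle game satisfies $$b_{mb}^c(\mathcal{OC}_n) \;\leq\; 0.47\, n .$$
   Context: $K_n$ is the complete graph on the vertex set $[n]=\{1,\dots,n\}$, and $\mathcal{OC}_n=\{E(C) : C \text{ an odd cycle in } K_n\}$. Connected (biased) Maker-Breaker game with bias $b$ and winning sets $\mathcal F\subset 2^{E(K_n)}$: the two players, Maker and Breaker, alternately claim previously unclaimed edges of $K_n$ (the board is $E(K_n)$), with perfect information. Maker moves first and claims $1$ edge per turn. Breaker claims $b$ edges per turn (all remaining edges if fewer than $b$ are left). Maker's first edge is arbitrary; afterwards Maker is only allowed to claim edges that are incident to (share a vertex with) her previously claimed edges. Maker wins if she succeeds in claiming all edges of some $F\in\mathcal F$. If she has not done so and is not able to make an allowed selection, she loses. Breaker wins if Maker does not win. The threshold bias $b_{mb}^c(\mathcal F)$ is the integer such that Breaker has a winning strategy in the connected game with bias $b$ if and only if $b\ge b_{mb}^c(\mathcal F)$. *)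

(* Defs.v *)
From mathcomp Require Import all_boot.

Set Implicit Arguments.
Unset Strict Implicit.
Unset Printing Implicit Defensive.

Definition edges n : {set {set 'I_n}} := [set e : {set 'I_n} | #|e| == 2].

(* A cycle in K_n is given by the cyclic sequence of its (at least three,
   distinct) vertices; [next c x] is the cyclic successor of [x] in [c]. *)
Definition cycle_edges n (c : seq 'I_n) : {set {set 'I_n}} :=
  [set [set x; next c x] | x in c].

Definition odd_cycles n (F : {set {set 'I_n}}) : Prop :=
  exists c : seq 'I_n,
    [/\ uniq c, 3 <= size c, odd (size c) & F = cycle_edges c].

(* A history lists the completed rounds in chronological order: Maker's edge
   and the set of edges with which Breaker answered. *)
Definition history n := seq ({set 'I_n} * {set {set 'I_n}}).

Definition maker_edges n (h : history n) : {set {set 'I_n}} :=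
  [set e in unzip1 h].

Definition breaker_edges n (h : history n) : {set {set 'I_n}} :=
  \bigcup_(r <- h) r.2.

Definition free_edges n (h : history n) : {set {set 'I_n}} :=
  edges n :\: (maker_edges h :|: breaker_edges h).

Definition maker_legal n (h : history n) (e : {set 'I_n}) : bool :=
  (e \in free_edges h) &&
  ((h == [::]) || [exists f in maker_edges h, e :&: f != set0]).

(* Breaker's answer [D], once Maker has claimed [e] after the history [h]. *)
Definition breaker_legal n (b : nat) (h : history n) (e : {set 'I_n})
    (D : {set {set 'I_n}}) : bool :=
  (D \subset free_edges h :\ e) && (#|D| == minn b #|free_edges h :\ e|).

Definition breaker_strategy n := history n -> {set 'I_n} -> {set {set 'I_n}}.

Inductive consistent n (sigma : breaker_strategy n) : history n -> Prop :=
| consistent_nil : consistent sigma [::]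
| consistent_round h e : consistent sigma h -> maker_legal h e ->
    consistent sigma (rcons h (e, sigma h e)).

(* The board is finite, so a play in which Maker never completes a winning set
   ends with Maker unable to move, i.e. with a win for Breaker. *)
Definition breaker_winning n (W : {set {set 'I_n}} -> Prop) (b : nat)
    (sigma : breaker_strategy n) : Prop :=
  forall h e, consistent sigma h -> maker_legal h e ->
    breaker_legal b h e (sigma h e) /\
    ~ exists2 F, W F & F \subset e |: maker_edges h.

Definition breaker_wins n (W : {set {set 'I_n}} -> Prop) (b : nat) : Prop :=
  exists sigma : breaker_strategy n, breaker_winning W b sigma.

Definition is_threshold_bias n (W : {set {set 'I_n}} -> Prop) (t : nat) : Prop :=
  forall b : nat, breaker_wins W b <-> t <= b.

(* Main.v *)
Require Import Defs.
From mathcomp Require Import all_boot all_order all_algebra.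
From mathcomp Require Import ring lra zify.
From Stdlib Require Import Classical ClassicalEpsilon.
Import Order.TTheory GRing.Theory Num.Theory.

(** Breaker wins with bias b = floor (0.47 n), and having a winning strategy is
    monotone in the bias, so the threshold exists and is at most b.

    While Breaker is winning, Maker's graph is connected and bipartite, with
    sides A and B, and Breaker owns every pair inside A and every pair inside B.
    Let U be the set of the m vertices outside A and B.  The only moves of Maker
    that matter are those where some u in U joins a side, say A, through a free
    edge to B: Breaker must then claim the free edges from u to A, and he spends
    the rest of his b edges on free edges between U and the two sides.  For each
    side he always attacks the vertices of U with the largest number of free
    edges to that side, so that these numbers stay nearly equal.  The state is
    then described by the water level at which a volume of VA (resp. VB) edges,
    spread evenly over U, would stand: no vertex of U has more than about VA / m
    free edges to A, or VB / m free edges to B.  When u joins A, the volumes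
    change by
      VA := VA - VA / m + m - (claimed),   VB := VB - VB / m - (claimed),
    so the removal of u lowers VB by VB / m for free.

    _Endgame._  Suppose that every vertex of U has at most c free edges to A, and
    let Breaker spend everything that is left on VB.  A vertex joining A lowers
    VB by at least rho = b - c and increases c by one, and a vertex joining B
    changes VB by m - b.  Hence, with tri x = x (x + 1), the inequality
      2 VB + tri (m - b) + tri (rho - m) <= tri rho
    (truncated subtractions) persists for the rest of the game, and it implies
    that Breaker can always afford the edges that he must claim
    ([cut_budget_join_cap] and [cut_budget_join_volume]).

    _Opening._  It remains to reach that inequality, for one of the two sides,
    within the first n / 2 joins.  There, each join increases VA + VB by at most
    m - b minus the free gift, which is VA / m or VB / m.  As long as neither
    inequality holds, both volumes are bounded below ([volume_lower_bound]), so
    the gifts are substantial.  This keeps VA + VB below an explicit quadratic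
    function ([opening_bound]) of the number of joins, which falls below the sum
    of the lower bounds for VA and VB by the time half of the vertices have
    joined, a contradiction ([opening_not_over]).  All these facts are packed in
    an invariant on the sets of edges owned by the players, which
    [invariant_breaker_wins] turns into a strategy. *)

Set Implicit Arguments.
Unset Strict Implicit.
Unset Printing Implicit Defensive.

(** * Numerical estimates *)

(** Twice a triangular number. *)
Definition tri (x : nat) : nat := x * x.+1.

(** The inequality that lets Breaker cut the side of volume [V] off the [m]
    outside vertices, when each of these has at most [c] free edges to the other
    side.  Truncated subtraction stands for the positive part. *)
Definition cut_budget (b m c V : nat) : bool :=
  2 * V + tri (m - b) + tri (b - c - m) <= tri (b - c).

Section Numeric.
Local Open Scope ring_scope.
Variable F : realFieldType.

(** The inequality behind the lower bound on the volumes.  All the quantities are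
    scaled: [t] is the proportion of the vertices that have joined, 36/100 the
    slope of the lower bound, and 37/100 the point where the parabola of
    [tangent_square] is replaced by its tangent; it is close to the values of
    [(b - VA / m) / n] for which the inequality is nearly tight. *)
Lemma cubic_lower_bound (t : F) : 15/100 <= t -> t <= 1/2 ->
  1/1000 <= (1-t)*(2*(37/100)*(47/100) - (37/100)^+2 - (53/100 - t)^+2)
   - 2 * (1-t-37/100) * (36/100*(1-t)*(t-15/100))
   - 2*(37/100)*(53/100*t - t^+2/2 - 18/100*(t-15/100)^+2).
Proof.
move=> h1 h2.
(* The cubic has its local minimum near 49/100, with a positive value. *)
have h : 0 <= (t - 49/100)^+2 * (t - 1/100).
  by apply: mulr_ge0; [exact: sqr_ge0 | lra].
nra.
Qed.

Lemma tangent_square (eps r : F) : 0 <= eps -> 0 <= r ->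
  2*(37/100)*r - (37/100)^+2 <= r * (r + eps).
Proof.
move=> e0 r0.
have h1 : 0 <= (r - 37/100)^+2 by exact: sqr_ge0.
have h2 : 0 <= r * eps by apply: mulr_ge0.
lra.
Qed.

Lemma excess_square (u x eps : F) : 0 <= eps -> eps * 200 <= 1/100 -> x <= 2/5 ->
  0 <= u -> u <= x + eps -> u * (u + eps) <= x^+2 + 3 * eps.
Proof.
move=> e0 e1 x1 u0 u1.
have h : u * (u + eps) <= (x + eps) * (x + 2 * eps) by apply: ler_pM => //; lra.
have h1 : x * eps <= 2/5 * eps by rewrite ler_wpM2r.
have h2 : eps * 200 * eps <= 1/100 * eps by rewrite ler_wpM2r.
lra.
Qed.

(** The lower bound on a volume, divided by [n ^+ 2]: [be], [a], [v] and [r] stand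
    for [b / n], [VA / n ^+ 2], [VB / n ^+ 2] and [(b - c) / n], and [eps] for
    [1 / n]. *)
Lemma scaled_volume_lower_bound (t be eps a v r : F) :
  0 <= eps -> eps * 200 <= 1/100 -> 15/100 <= t -> t <= 1/2 ->
  47/100 - eps <= be -> be <= 47/100 -> 0 <= r ->
  a + v <= 53/100*t - t^+2/2 - 18/100*(t-15/100)^+2 + 10*eps*t + 2*eps ->
  (1 - t) * (be - eps - r) <= a ->
  r * (r + eps) < 2 * v + (1 - t - be) * (1 - t - be + eps) ->
  36/100 * (1-t) * (t-15/100) <= v.
Proof.
move=> e0 e1 t0 t1 b0 b1 r0 hav ha hr.
rewrite leNgt; apply/negP => hv.
have h3 : 2*(37/100)*r - (37/100)^+2 <= 2 * v + (53/100 - t)^+2 + 3 * eps.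
  have hX := tangent_square e0 r0.
  have hZ : (1 - t - be) * (1 - t - be + eps) <= (53/100 - t)^+2 + 3 * eps.
    by apply: excess_square => //; clear -t0 t1 b0 b1 e0 e1; lra.
  move: hX hZ hr; move: (r * _) (_ * (1 - t - be + eps)) ((53/100 - t)^+2) => X Z W.
  by clear => hX hZ hr; lra.
have h4 : (1-t) * (2*(37/100)*r - (37/100)^+2) <= (1-t) * (2 * v + (53/100 - t)^+2 + 3 * eps).
  by apply: ler_wpM2l => //; clear -t1; lra.
have h5 : (1-t) * eps <= eps by clear -e0 t0; nra.
have h6 : (1-t)*(47/100 - eps) <= (1-t) * be by apply: ler_wpM2l => //; clear -t1; lra.
have h7 : eps * t <= eps by clear -e0 t1; nra.
have h8 : 2 * (1-t-37/100) * v <= 2 * (1-t-37/100) * (36/100*(1-t)*(t-15/100)).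
  by apply: ler_wpM2l; [clear -t1; lra | exact: ltW].
have hc := cubic_lower_bound t0 t1.
move: hc h8 hav; move: (36/100*(1-t)*(t-15/100)) => G.
clear hv hr h3 r0 b0 b1 t1.
move: ((t - 15/100)^+2) => Q.
move=> hc h8 hav.
lra.
Qed.

(** The upper bound on [VA + VB] in the opening, when [m] vertices are outside.
    The first two terms sum [m - b] over the joins, and the third one is a lower
    bound on the total of the free gifts, which is only useful once 15/100 of the
    vertices have joined.  The last two absorb the initial volumes and rounding
    errors. *)
Definition opening_bound (n m : F) : F :=
  53/100 * n * (n - m) - (n - m)^+2 / 2
  - 18/100 * (Num.max 0 (n - m - 15/100 * n))^+2 + 10 * (n - m) + 2 * n.

Lemma opening_bound_le (n m : F) :
  opening_bound n m <= 53/100 * n * (n - m) - (n - m)^+2 / 2 + 10 * (n - m) + 2 * n.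
Proof.
rewrite /opening_bound; have := sqr_ge0 (Num.max 0 (n - m - 15/100 * n)).
move: (Num.max _ _ ^+ 2) => X; lra.
Qed.

Lemma opening_bound_late (n m : F) : 15/100 * n <= n - m ->
  opening_bound n m = 53/100 * n * (n - m) - (n - m)^+2 / 2
  - 18/100 * (n - m - 15/100 * n)^+2 + 10 * (n - m) + 2 * n.
Proof. by move=> h; rewrite /opening_bound max_r // subr_ge0. Qed.

Lemma opening_bound_ge0 (n m : F) : n <= 2 * m -> m <= n -> 0 <= opening_bound n m.
Proof.
move=> m0 m1; rewrite /opening_bound.
have [y0 yn] : 0 <= Num.max 0 (n - m - 15/100 * n) /\ Num.max 0 (n - m - 15/100 * n) <= n - m.
  split; first by rewrite le_max lexx.
  by rewrite ge_max; apply/andP; split; clear -m0 m1; lra.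
have n0 : 0 <= n by clear -m0 m1; lra.
have h1 : Num.max 0 (n - m - 15/100 * n) ^+2 <= (n - m)^+2.
  by rewrite ler_sqr // nnegrE; clear -m1; lra.
have h2 : 0 <= (2 * m - n) * (n - m) by rewrite mulr_ge0 //; [clear -m0 | clear -m1]; lra.
move: h1; move: (Num.max _ _ ^+2) => Y; clear -h2 n0 m1 => h1; nra.
Qed.

Lemma opening_bound_start (n : F) : 200 * 100 <= n -> (n - 2) + (n - 2) <= opening_bound n (n - 2).
Proof.
move=> n0; rewrite /opening_bound max_l; last by clear -n0; lra.
clear -n0; lra.
Qed.

(** In the opening, if the endgame inequality fails for the side of volume [VB],
    then [VB] is large; [rho] stands for [b - c]. *)
Lemma volume_lower_bound (n m b VA VB rho : F) :
  200 * 100 <= n -> n <= 2 * m -> m <= n ->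
  47/100 * n - 1 <= b -> b <= 47/100 * n -> 0 <= rho ->
  VA + VB <= opening_bound n m -> m * (b - 1 - rho) <= VA ->
  rho * (rho + 1) < 2 * VB + (m - b) * (m - b + 1) ->
  15/100 * n <= n - m ->
  36/100 * m * (n - m - 15/100 * n) <= VB.
Proof.
move=> n0 m0 m1 b0 b1 r0 hPhi hA hB hx.
have np : 0 < n by clear -n0; lra.
have nn : n != 0 by rewrite gt_eqF.
have n2 : 0 < n ^+ 2 by rewrite exprn_gt0.
have key := @scaled_volume_lower_bound ((n - m) / n) (b / n) (1 / n) (VA / n^+2) (VB / n^+2) (rho / n).
have -> : 36/100 * m * (n - m - 15/100 * n) =
  36/100 * (1 - (n-m)/n) * ((n-m)/n - 15/100) * n^+2 by field.
rewrite -ler_pdivlMr //; apply: key.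
- by rewrite divr_ge0 // ?ltW.
- rewrite mulrAC mul1r ler_pdivrMr //; clear -n0; lra.
- by rewrite ler_pdivlMr.
- rewrite ler_pdivrMr //; clear -m0; lra.
- rewrite -(ler_pM2r np) mulrBl !divfK //; clear -b0; lra.
- by rewrite ler_pdivrMr.
- by rewrite divr_ge0 // ltW.
- move: hPhi; rewrite opening_bound_late // => h.
  rewrite -mulrDl ler_pdivrMr //.
  apply: le_trans h _; rewrite le_eqVlt; apply/orP; left; apply/eqP; field.
  exact: nn.
- rewrite ler_pdivlMr //.
  have -> : (1 - (n - m) / n) * (b / n - 1 / n - rho / n) * n ^+ 2 = m * (b - 1 - rho) by field.
  exact: hA.
- rewrite -(ltr_pM2r n2).
  have -> : rho / n * (rho / n + 1 / n) * n ^+ 2 = rho * (rho + 1) by field.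
  have -> // : (2 * (VB / n ^+ 2) + (1 - (n - m) / n - b / n) * (1 - (n - m) / n - b / n + 1 / n)) *
     n ^+ 2 = 2 * VB + (m - b) * (m - b + 1) by field.
Qed.

(** In the opening Breaker can afford the edges that he must claim, since a vertex
    outside has at most [h + 1] free edges to the side that it joins. *)
Lemma opening_affordable (n m b h V V' : F) :
  200 * 100 <= n -> n <= 2 * m -> m <= n -> 47/100 * n - 1 <= b ->
  0 <= V' -> V + V' <= opening_bound n m -> m * h <= V -> h + 1 <= b.
Proof.
move=> n0 m0 m1 b0 v0 hPhi hh; rewrite leNgt; apply/negP => hlt.
have hP := opening_bound_le n m.
have h1 : m * (47/100 * n - 2) <= m * h.
  by rewrite ler_wpM2l //; [clear -m0 n0 | clear -b0 hlt]; lra.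
have h2 : 0 <= (2 * m - n) * (n - m) by rewrite mulr_ge0 //; [clear -m0 | clear -m1]; lra.
have h3 : 200 * 100 * n <= n * n by rewrite ler_wpM2r //; clear -n0; lra.
have h4 : 0 <= (2 * m - n) * n by rewrite mulr_ge0 //; [clear -m0 | clear -n0]; lra.
move: h1 h2 h3 h4 hP hh hPhi; move: (opening_bound n m) => P.
clear -n0 m0 m1 v0; nra.
Qed.

(** The lower bounds on the volumes contradict their upper bound when half of the
    vertices have joined. *)
Lemma opening_not_over (n m VA VB : F) :
  200 * 100 <= n -> n <= 2 * m -> m <= n ->
  VA + VB <= opening_bound n m ->
  (15/100 * n <= n - m -> 36/100 * m * (n - m - 15/100 * n) <= VA) ->
  (15/100 * n <= n - m -> 36/100 * m * (n - m - 15/100 * n) <= VB) ->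
  n + 2 <= 2 * m.
Proof.
move=> n0 m0 m1 hPhi gA gB; rewrite leNgt; apply/negP => hlt.
have hx : 15/100 * n <= n - m by clear -n0 hlt; lra.
have := gA hx; have := gB hx; move: hPhi; rewrite opening_bound_late //; clear gA gB hx.
have [s [s0 s1 ->]] : exists s, [/\ 0 <= s, s <= 1 & m = n / 2 + s].
  by exists (m - n / 2); split; clear -m0 hlt; lra.
have h1 : n * s <= n * 1 by rewrite ler_wpM2l //; clear -n0; lra.
have h2 : 0 <= n * s by rewrite mulr_ge0 //; clear -n0; lra.
have h3 : s * s <= 1 * 1 by apply: ler_pM.
have h4 : 200 * 100 * n <= n * n by rewrite ler_wpM2r //; clear -n0; lra.
clear -n0 s0 s1 h1 h2 h3 h4 => hPhi gB gA; lra.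
Qed.

(** A join, with its gift [hB], preserves the upper bound. *)
Lemma opening_bound_join (n m b hB VA VB : F) :
  200 * 100 <= n -> 47/100 * n - 1 <= b -> 0 <= hB -> 0 < m ->
  VA + VB <= opening_bound n m -> VB <= m * (hB + 1) ->
  (15/100 * n <= n - m -> 36/100 * m * (n - m - 15/100 * n) <= VB) ->
  VA + VB + m - hB - b <= opening_bound n (m - 1).
Proof.
move=> n0 b0 hB0 mp hPhi hVB gB.
have {gB hVB} hx : 36/100 * Num.max 0 (n - m - 15/100 * n) <= hB + 1.
  have [h|h] := leP (n - m - 15/100 * n) 0; first by clear -hB0; lra.
  rewrite -(ler_pM2l mp); apply: le_trans hVB.
  by apply: le_trans (gB _); [clear|move: h; clear]; lra.
have hy : Num.max 0 (n - (m - 1) - 15/100 * n) <= Num.max 0 (n - m - 15/100 * n) + 1.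
  rewrite ge_max; apply/andP; split.
    have : 0 <= Num.max 0 (n - m - 15/100 * n) by rewrite le_max lexx.
    move: (Num.max _ _) => X; lra.
  have : n - m - 15/100 * n <= Num.max 0 (n - m - 15/100 * n) by rewrite le_max lexx orbT.
  move: (Num.max _ _) => X; lra.
have hz : 0 <= Num.max 0 (n - (m - 1) - 15/100 * n) by rewrite le_max lexx.
move: hPhi; rewrite /opening_bound; move: hx hy hz.
move: (Num.max 0 (n - (m-1) - _)) (Num.max 0 (n - m - _)) => Y X.
clear -b0 hB0 => hx hy hz.
have : Y ^+2 <= (X + 1)^+2 by rewrite ler_sqr ?nnegrE //; apply: le_trans hy.
clear hy hz; lra.
Qed.
End Numeric.

Lemma triS x : tri x.+1 = tri x + 2 * x.+1.
Proof. rewrite /tri; lia. Qed.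

Lemma leq_tri x y : x <= y -> tri x <= tri y.
Proof. by move=> le_xy; rewrite /tri leq_mul. Qed.

(** A vertex joins the side with the cap [c], at a cost of at most [c]. *)
Lemma cut_budget_join_cap b m c V : 0 < m -> 0 < V -> cut_budget b m c V ->
  c < b /\ cut_budget b m.-1 c.+1 (V - (b - c)).
Proof.
case: m => // m _ V0; rewrite /cut_budget /= => hk.
have [r hr] : exists r, b - c = r.+1.
  case: (b - c) hk => [|r] hk; last by exists r.
  by have : 2 * V <= tri 0; [apply: leq_trans hk; rewrite -addnA leq_addr | rewrite [tri 0]mul0n; lia].
split; first lia.
have -> : b - c.+1 = r by lia.
move: hk; rewrite hr subSS => hk.
have [leV|ltV] := leqP r.+1 V.
  have : tri (m - b) <= tri (m.+1 - b) by apply: leq_tri; lia.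
  by move: hk; rewrite triS; lia.
have -> : V - r.+1 = 0 by lia.
have [le_bm|lt_mb] := leqP b m.
  have -> : r - m = 0 by lia.
  have : m - b < r.
    rewrite ltnNge; apply/negP => h.
    have : tri r.+1 <= tri (m.+1 - b) by apply: leq_tri; lia.
    lia.
  by move=> h; rewrite muln0 [tri 0]mul0n add0n addn0 leq_tri // ltnW.
have -> : m - b = 0 by lia.
by rewrite muln0 [tri 0]mul0n !add0n leq_tri // leq_subr.
Qed.

(** A vertex joins the side with the volume [V], which stands at level [h], at a
    cost of at most [h.+1]. *)
Lemma cut_budget_join_volume b m c V h : 0 < m -> 0 < c -> 0 < b -> m * h <= V ->
  cut_budget b m c V ->
  h < b /\ cut_budget b m.-1 c ((V - h + m.-1) - (b - h.+1)).
Proof.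
case: m => // m _ c0 b0 hV; rewrite /cut_budget /= => hk.
have hb : h < b.
  have : h <= b - c; last lia.
  move: hk; move: (b - c) => r hk.
  have [le_mr|lt_rm] := leqP m.+1 r.
    have [s hs] : exists s, r = m.+1 + s by exists (r - m.+1); lia.
    move: hk; rewrite hs addKn /tri => hk; clear le_mr hs r; nia.
  move: hk; rewrite /tri => hk; nia.
split=> //.
have hVh : h <= V by nia.
have [le_bm|lt_mb] := leqP b m.
  have -> : b - c - m = 0 by lia.
  move: hk; have -> : b - c - m.+1 = 0 by lia.
  by rewrite subSn // triS; lia.
have -> : m - b = 0 by lia.
have [le_bV|lt_Vb] := leqP (b - h.+1) (V - h + m); last first.
  have -> : V - h + m - (b - h.+1) = 0 by lia.
  by rewrite muln0 [tri 0]mul0n !add0n leq_tri // leq_subr.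
have [le_mr|lt_rm] := leqP m.+1 (b - c); last first.
  have -> : b - c - m = 0 by lia.
  move: hk; have -> : b - c - m.+1 = 0 by lia.
  have -> : m.+1 - b = 0 by lia.
  lia.
have -> : b - c - m = (b - c - m.+1).+1 by lia.
by rewrite triS [tri 0]mul0n; lia.
Qed.

(** One join in the opening, as long as neither endgame inequality holds. *)
Lemma opening_join_numbers (F : realFieldType) n m b hA hB VA VB :
  (200 * 100 <= n%:R :> F)%R -> 0 < m -> m <= n -> n <= 2 * m ->
  47 * n < 100 * b + 100 -> 100 * b <= 47 * n ->
  m * hA <= VA -> m * hB <= VB <= m * hB.+1 ->
  ((VA + VB)%:R <= opening_bound n%:R m%:R :> F)%R ->
  ~~ cut_budget b m hA.+1 VB -> ~~ cut_budget b m hB.+1 VA ->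
  [/\ hA < b, n <= 2 * m.-1 &
    ((VA - hA + m.-1 + (VB - hB) - (b - hA.+1))%:R
       <= opening_bound n%:R m.-1%:R :> F)%R].
Proof.
move=> n0R m0' m1 m0 b0 b1 hVA /andP[hVB hVB'] hPhi kA kB.
have m1R : (m%:R <= n%:R :> F)%R by rewrite ler_nat.
have m0R : (n%:R <= 2 * m%:R :> F)%R by rewrite -natrM ler_nat.
have b1R : (b%:R <= 47/100 * n%:R :> F)%R.
  have : ((100 * b)%:R <= (47 * n)%:R :> F)%R by rewrite ler_nat.
  by rewrite !natrM; clear; lra.
have b0R : (47/100 * n%:R - 1 <= b%:R :> F)%R.
  have : ((47 * n)%:R <= (100 * b + 100)%:R :> F)%R by rewrite ler_nat ltnW.
  by rewrite natrD !natrM; clear; lra.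
have gift V V' h : ((V + V')%:R <= opening_bound n%:R m%:R :> F)%R -> m * h <= V ->
    ~~ cut_budget b m h.+1 V' ->
    (15/100 * n%:R <= n%:R - m%:R :> F ->
      36/100 * m%:R * (n%:R - m%:R - 15/100 * n%:R) <= V'%:R :> F)%R.
  rewrite natrD => hP hV; rewrite /cut_budget.
  have -> : b - h.+1 - m = 0 by clear -m0 b1; lia.
  rewrite -ltnNge addn0 => kh.
  apply: (volume_lower_bound n0R m0R m1R b0R b1R (ler0n _ (b - h.+1)) hP).
    have : ((m * (b - 1 - (b - h.+1)))%:R <= V%:R :> F)%R.
      by rewrite ler_nat; apply: leq_trans hV; rewrite leq_mul2l; apply/orP; right; clear; lia.
    apply: le_trans; rewrite natrM ler_wpM2l ?ler0n //.
    by rewrite !lerBlDr -natrD natr1 ler_nat; clear; lia.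
  have : ((tri (b - h.+1))%:R < (2 * V' + tri (m - b))%:R :> F)%R by rewrite ltr_nat.
  have le_bm : b <= m by clear -m0 b1; lia.
  by rewrite /tri natrD !natrM -!natr1 (natrB _ le_bm).
have gB := gift _ _ _ hPhi hVA kA.
have gA : (15/100 * n%:R <= n%:R - m%:R :> F ->
    36/100 * m%:R * (n%:R - m%:R - 15/100 * n%:R) <= VA%:R :> F)%R.
  by apply: (gift VB VA hB _ hVB kB); rewrite addnC.
move: hPhi; rewrite natrD => hPhi.
have hAb : hA < b.
  have := opening_affordable n0R m0R m1R b0R (ler0n _ _) hPhi (h := hA%:R).
  by rewrite natr1 -natrM !ler_nat => h; apply: h hVA.
have hm : n <= 2 * m.-1.
  have := opening_not_over n0R m0R m1R hPhi gA gB.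
  by rewrite -natrM -natrD ler_nat; clear; lia.
split=> //.
have hVAA : hA <= VA by apply: leq_trans hVA; rewrite leq_pmull.
have hVBB : hB <= VB by apply: leq_trans hVB; rewrite leq_pmull.
set W := VA - hA + m.-1 + (VB - hB).
have [hW|hW] := leqP W (b - hA.+1).
  have -> : W - (b - hA.+1) = 0 by apply/eqP; rewrite subn_eq0.
  apply: opening_bound_ge0; rewrite -?natrM ler_nat //; clear -m1; lia.
have := opening_bound_join n0R b0R (ler0n _ hB) _ hPhi _ gB.
rewrite natr1 -natrM ler_nat ltr0n => /(_ m0' hVB').
rewrite -(natrB _ m0') subn1; apply: le_trans.
rewrite -!natrD -!lerBlDr !opprK -!natrD ler_nat; move: hW hVAA hVBB hAb m0'; rewrite /W; clear; lia.
Qed.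

(** * Strategies from invariants, and monotonicity in the bias *)

Lemma exists_subset_card (T : finType) (Y : {set T}) k :
  k <= #|Y| -> exists2 X : {set T}, X \subset Y & #|X| = k.
Proof.
move=> le_kY; exists [set x in take k (enum Y)].
  by apply/subsetP=> x; rewrite inE => /mem_take; rewrite mem_enum.
rewrite cardsE (card_uniqP _) ?take_uniq ?enum_uniq // size_take -cardE.
by case: ltngtP le_kY.
Qed.

Lemma exists_superset_card (T : finType) (D Y : {set T}) b :
  D \subset Y -> #|D| <= b ->
  exists2 X : {set T}, D \subset X & (X \subset Y) && (#|X| == minn b #|Y|).
Proof.
move=> sDY leDb.
have [|X sX cX] := @exists_subset_card _ (Y :\: D) (minn b #|Y| - #|D|).
  by have := cardsID D Y; rewrite (setIidPr sDY); lia.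
exists (D :|: X); first exact: subsetUl.
rewrite subUset sDY (subset_trans sX (subsetDl _ _)) /=.
have dDX : D :&: X = set0.
  apply/eqP; rewrite setI_eq0 disjoint_sym.
  by move: sX; rewrite subsetD => /andP[].
have := subset_leq_card sDY.
by rewrite cardsU dDX cards0 subn0 cX; lia.
Qed.

Section Game.
Variables (n : nat) (W : {set {set 'I_n}} -> Prop).
Implicit Types (M K D : {set {set 'I_n}}) (e : {set 'I_n}) (h : history n).

Lemma maker_edges_rcons h e D :
  maker_edges (rcons h (e, D)) = e |: maker_edges h.
Proof.
by apply/setP=> x; rewrite !inE /unzip1 map_rcons mem_rcons inE.
Qed.

Lemma breaker_edges_rcons h e D :
  breaker_edges (rcons h (e, D)) = breaker_edges h :|: D.
Proof. by rewrite /breaker_edges -cats1 big_cat big_seq1. Qed.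

Lemma maker_edges_eq0 h : (maker_edges h == set0) = (h == [::]).
Proof.
case: h => [|[e D] h]; first last.
  by apply: negbTE; apply/set0Pn; exists e; rewrite !inE eqxx.
suff -> : maker_edges [::] = set0 :> {set {set 'I_n}} by rewrite !eqxx.
by apply/setP=> x; rewrite !inE.
Qed.

(** Maker, who owns [M], may claim the free edge [e]. *)
Definition touches M e : bool := (M == set0) || [exists f in M, e :&: f != set0].

(** A property [I] of the edges [M] of Maker and [K] of Breaker is maintained by
    Breaker: he can answer each edge of Maker by at most [b] edges.  Asking for
    [I] with any larger set of edges of Breaker makes the extra edges that the
    rules may force him to claim harmless. *)
Definition invariant_step (b : nat) (I : {set {set 'I_n}} -> {set {set 'I_n}} -> Prop) :=
  forall M K e, I M K -> e \in edges n -> e \notin M -> e \notin K -> touches M e ->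
  ~ (exists2 F, W F & F \subset e |: M) /\
  exists D, [/\ D \subset edges n :\: (M :|: K) :\ e, #|D| <= b &
    forall K', K :|: D \subset K' -> I (e |: M) K'].

Lemma invariant_breaker_wins b I :
  I set0 set0 -> invariant_step b I -> breaker_wins W b.
Proof.
move=> I0 Istep.
pose good h e D := breaker_legal b h e D /\
  I (e |: maker_edges h) (breaker_edges h :|: D).
pose sigma : breaker_strategy n := fun h e => epsilon (inhabits set0) (good h e).
have step h e : I (maker_edges h) (breaker_edges h) -> maker_legal h e ->
    good h e (sigma h e) /\ ~ exists2 F, W F & F \subset e |: maker_edges h.
  move=> Ih /andP[]; rewrite in_setD in_setU negb_or => /andP[/andP[eM eK] ee] et.
  have {}et : touches (maker_edges h) e by rewrite /touches maker_edges_eq0.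
  have [noW [D [sD cD ID]]] := Istep _ _ e Ih ee eM eK et.
  split=> //; apply: epsilon_spec.
  have [X sDX /andP[sX cX]] := exists_superset_card sD cD.
  exists X; split; first by rewrite /breaker_legal sX.
  exact/ID/setUS.
have main h : consistent sigma h -> I (maker_edges h) (breaker_edges h).
  elim=> [|h' e ch Ih le].
    have -> : maker_edges [::] = set0 :> {set {set 'I_n}}.
      by apply/eqP; rewrite maker_edges_eq0.
    by rewrite /breaker_edges big_nil.
  rewrite maker_edges_rcons breaker_edges_rcons.
  by have [[]] := step _ _ Ih le.
exists sigma => h e /main Ih le.
by have [[]] := step _ _ Ih le.
Qed.

(** With the larger bias, Breaker follows the winning strategy for the smaller
    one on an imagined play, in which he owns fewer edges. *)
Lemma breaker_wins_leq b b' : b <= b' -> breaker_wins W b -> breaker_wins W b'.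
Proof.
move=> le_bb' [sigma win].
apply: (invariant_breaker_wins (I := fun M K => exists h,
  [/\ consistent sigma h, maker_edges h = M & breaker_edges h \subset K])).
  exists [::]; split; first exact: consistent_nil.
    by apply/eqP; rewrite maker_edges_eq0.
  by rewrite /breaker_edges big_nil sub0set.
move=> _ K e [h [ch <- sK]] ee eM eK et.
have eB : e \notin breaker_edges h by apply: contra eK; apply: (subsetP sK).
have le : maker_legal h e.
  by rewrite /maker_legal /free_edges in_setD in_setU negb_or eM eB ee -maker_edges_eq0.
have [/andP[sD /eqP cD] noW] := win h e ch le.
split=> //; exists (sigma h e :\: K); split.
- apply/subsetP=> x /setDP[/(subsetP sD)]; rewrite !inE.
  by rewrite !negb_or => /andP[-> /andP[/andP[-> _] ->]] ->.
- apply: leq_trans (subset_leq_card (subsetDl _ _)) _.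
  by rewrite cD; apply: leq_trans (geq_minl _ _) _.
- move=> K' sK'; exists (rcons h (e, sigma h e)); split.
  + exact: consistent_round.
  + exact: maker_edges_rcons.
  rewrite breaker_edges_rcons; apply: subset_trans sK'.
  apply/subsetP=> x; rewrite !inE => /orP[/(subsetP sK)->//|->].
  by rewrite andbT orbN.
Qed.

Lemma threshold_exists b : breaker_wins W b ->
  exists2 t, is_threshold_bias W t & t <= b.
Proof.
elim: b => [|b IHb] wb.
  by exists 0 => // b; split=> // _; apply: breaker_wins_leq wb.
have [/IHb[t tW tb]|nwb] := classic (breaker_wins W b).
  by exists t => //; apply: leqW.
exists b.+1 => // c; split=> [wc|]; last by move/breaker_wins_leq; apply.
rewrite ltnNge; apply/negP=> le_cb; apply: nwb.
exact: breaker_wins_leq le_cb wc.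
Qed.

End Game.

(** Membership in [A] cannot alternate along an odd cycle. *)
Lemma odd_cycle_not_bipartite n (c : seq 'I_n) (A : {set 'I_n}) :
  uniq c -> odd (size c) ->
  ~ (forall x, x \in c -> (next c x \in A) = (x \notin A)).
Proof.
move=> Uc oc alt.
have : count (fun x => x \in A) c = count (fun x => x \notin A) c.
  (* [next c] permutes [c]. *)
  transitivity (count (fun x => x \in A) (map (next c) c)).
    apply/permP/uniq_perm=> //.
      by rewrite map_inj_uniq //; apply: can_inj (prev_next Uc).
    move=> x; apply/idP/mapP=> [xc|[y yc ->]]; last by rewrite mem_next.
    by exists (prev c x); rewrite ?mem_prev // next_prev.
  by rewrite count_map; apply: eq_in_count => x /alt /= ->.
have h : count (fun x => x \in A) c + count (fun x => x \notin A) c = size c.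
  exact: count_predC.
by move=> eqc; move: oc; rewrite -h eqc addnn odd_double.
Qed.

(** * Evenly spread volumes *)

Section WaterLevel.
Variable T : finType.
Implicit Types (U : {set T}) (f : T -> nat).

(** A volume [V] covers the profile [f] over [U] at the level [h]: all the values
    are at most [h.+1], and those equal to [h.+1] fit in what is left of [V] once
    it is filled up to [h] everywhere. *)
Definition water_level U f h V :=
  (forall u, u \in U -> f u <= h.+1) /\ #|U| * h + #|[set u in U | h < f u]| <= V.

(** A volume [V] covers the profile [f] over [U] at some level. *)
Definition fits U f V := exists h, water_level U f h V.

Lemma fits_le U f f' V V' : (forall u, u \in U -> f' u <= f u) -> V <= V' ->
  fits U f V -> fits U f' V'.
Proof.
move=> le_f le_V [h [fh hV]]; exists h; split=> [u uU|].
  exact: leq_trans (le_f u uU) (fh u uU).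
apply: leq_trans le_V; apply: leq_trans hV; rewrite leq_add2l.
apply/subset_leq_card/subsetP=> u; rewrite !inE => /andP[uU hu].
by rewrite uU (leq_trans hu) ?le_f.
Qed.

Lemma water_level_const U f c : (forall u, u \in U -> f u <= c) ->
  water_level U f c (#|U| * c).
Proof.
move=> fc; split=> [u /fc/leqW//|].
suff -> : [set u in U | c < f u] = set0 by rewrite cards0 addn0.
by apply/setP=> u; rewrite !inE; apply/andP=> -[/fc]; rewrite leqNgt => /negP.
Qed.

Lemma water_level_exact U f h V : water_level U f h V ->
  exists V', [/\ water_level U f h V', #|U| * h <= V' <= #|U| * h.+1 & V' <= V].
Proof.
case=> fh hV; exists (#|U| * h + #|[set u in U | h < f u]|); split=> //.
rewrite leq_addr mulnS addnC leq_add2r.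
by apply/subset_leq_card/subsetP=> u; rewrite inE => /andP[].
Qed.

(** The free gift: removing a point lowers the volume by the level. *)
Lemma fits_remove U f h V u : u \in U -> water_level U f h V ->
  fits (U :\ u) f (V - h).
Proof.
move=> uU [fh hV]; exists h; split=> [w|]; first by rewrite !inE => /andP[_ /fh].
have : #|[set w in U :\ u | h < f w]| <= #|[set w in U | h < f w]|.
  by apply/subset_leq_card/subsetP=> w; rewrite !inE => /andP[/andP[_ ->]].
move: hV; rewrite (cardsD1 u U) uU; nia.
Qed.

Lemma fits_add1 U f f' V : (forall u, u \in U -> f' u <= (f u).+1) ->
  fits U f V -> fits U f' (V + #|U|).
Proof.
move=> le_f [h [fh hV]]; exists h.+1; split=> [u uU|].
  by apply: leq_trans (le_f u uU) _; rewrite ltnS fh.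
rewrite mulnS addnC addnCA addnC leq_add2r; apply: leq_trans hV.
rewrite addnC leq_add2l; apply/subset_leq_card/subsetP=> u.
by rewrite !inE => /andP[uU hu]; rewrite uU; have := le_f u uU; lia.
Qed.

Lemma fits_gt0 U f V u : u \in U -> 0 < f u -> fits U f V -> 0 < V.
Proof.
move=> uU fu [h [fh hV]]; apply: leq_trans hV.
case: h fh => [|h] _; last first.
  by rewrite addn_gt0 muln_gt0 /= andbT; apply/orP; left; apply/card_gt0P; exists u.
by rewrite muln0; apply/card_gt0P; exists u; rewrite inE uU.
Qed.

End WaterLevel.

(** * Breaker's answer to a join *)

Section Board.
Variable n : nat.
Implicit Types (M K D : {set {set 'I_n}}) (e A B S U : {set 'I_n}).

(** The number of edges from [u] to [S] that Breaker, who owns [K], has not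
    claimed. *)
Definition open_degree K S u := #|[set x in S | [set u; x] \notin K]|.

Lemma open_degree_anti K K' S u : K \subset K' -> open_degree K' S u <= open_degree K S u.
Proof.
move=> sK; apply/subset_leq_card/subsetP=> x; rewrite !inE => /andP[-> /=].
by apply: contra; apply: (subsetP sK).
Qed.

Lemma open_degree_add K S v u : open_degree K (v |: S) u <= (open_degree K S u).+1.
Proof.
rewrite -add1n -(cards1 v); apply: leq_trans (leq_card_setU _ _).
apply/subset_leq_card/subsetP=> x; rewrite !inE => /andP[/orP[->|->] //= ->].
by rewrite orbT.
Qed.

(** An edge between [U] and [S]. *)
Definition crossing U S e := exists u x, [/\ u \in U, x \in S & e = [set u; x]].

Lemma claim_one U S K V : fits U (open_degree K S) V ->
  exists D, [/\ forall e, e \in D -> crossing U S e /\ e \notin K, #|D| <= 1 &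
    fits U (open_degree (K :|: D) S) V.-1].
Proof.
have EM_level h : (exists2 u, u \in U & h < open_degree K S u) \/
    (forall u, u \in U -> ~ h < open_degree K S u).
  case: (pickP [pred u in U | h < open_degree K S u]) => [u /andP[uU hu]|none].
    by left; exists u.
  by right=> u uU hu; have := none u; rewrite inE /= uU hu.
have claim h u : (forall w, w \in U -> open_degree K S w <= h.+1) ->
    #|U| * h + #|[set w in U | h < open_degree K S w]| <= V ->
    u \in U -> h < open_degree K S u ->
    exists D, [/\ forall e, e \in D -> crossing U S e /\ e \notin K, #|D| <= 1 &
    fits U (open_degree (K :|: D) S) V.-1].
  move=> fh hV uU hu.
  have /card_gt0P[x] : 0 < open_degree K S u by apply: leq_trans hu.
  rewrite inE => /andP[xS uxK]; exists [set [set u; x]]; split=> [e||].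
  - by rewrite inE => /eqP ->; split=> //; exists u, x.
  - by rewrite cards1.
  have sK : K \subset K :|: [set [set u; x]] by exact: subsetUl.
  exists h; split=> [w wU|]; first exact: leq_trans (open_degree_anti _ _ sK) (fh w wU).
  have hu' : open_degree (K :|: [set [set u; x]]) S u <= h.
    rewrite -ltnS; apply: leq_trans (fh u uU).
    apply/proper_card/properP; split.
      apply/subsetP=> y; rewrite !inE => /andP[-> /=].
      by rewrite negb_or => /andP[].
    by exists x; rewrite !inE ?xS ?eqxx ?orbT.
  have le_c : #|[set w in U | h < open_degree (K :|: [set [set u; x]]) S w]|
      <= #|[set w in U | h < open_degree K S w] :\ u|.
    apply/subset_leq_card/subsetP=> w; rewrite !inE => /andP[wU hw].
    rewrite wU (leq_trans hw (open_degree_anti _ _ sK)) !andbT.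
    by apply: contraL hw => /eqP ->; rewrite -leqNgt.
  by move: hV; rewrite [#|[set w in U | _]|](cardsD1 u) inE uU hu; move: le_c; lia.
(* Either some vertex reaches the level [h.+1], and an edge at it is claimed,
   or the level may be taken to be one less. *)
case=> h; elim: h => [|h IHh] [fh hV]; last first.
  have [[u uU hu]|none] := EM_level h.+1; first exact: (claim _ _ fh hV uU hu).
  apply: IHh; split=> [u uU|]; first by rewrite leqNgt; apply/negP=> /(none u uU).
  apply: leq_trans hV; rewrite mulnS addnC; apply: leq_trans (leq_addr _ _).
  by rewrite leq_add2r; apply/subset_leq_card/subsetP=> u; rewrite inE => /andP[].
have [[u uU hu]|none] := EM_level 0; first exact: (claim _ _ fh hV uU hu).
exists set0; split=> [e||]; rewrite ?inE ?cards0 ?setU0 //.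
exists 0; split=> //; rewrite muln0.
suff -> : [set u in U | 0 < open_degree K S u] = set0 by rewrite cards0.
by apply/setP=> u; rewrite !inE; apply/andP=> -[/none hn /hn].
Qed.

(** Claiming [r] well-chosen edges lowers the volume by [r]. *)
Lemma claim_many U S K V r : fits U (open_degree K S) V ->
  exists D, [/\ forall e, e \in D -> crossing U S e /\ e \notin K, #|D| <= r &
    fits U (open_degree (K :|: D) S) (V - r)].
Proof.
elim: r V K => [|r IHr] V K fV.
  by exists set0; split=> [e||]; rewrite ?inE ?cards0 ?setU0 ?subn0.
have [D [DK cD /IHr[D' [DK' cD' fV']]]] := claim_one fV.
exists (D :|: D'); split=> [e||].
- rewrite inE => /orP[/DK//|/DK'[ce]]; rewrite inE negb_or => /andP[eK _]; by split.
- by apply: leq_trans (leq_card_setU _ _) _; rewrite -add1n leq_add.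
- by rewrite setUA; move: fV'; rewrite -subn1 -subnDA add1n.
Qed.

(** The vertices that have not joined Maker's graph, with sides [A] and [B]. *)
Definition outside A B := ~: (A :|: B).

Lemma outsideC A B : outside A B = outside B A.
Proof. by rewrite /outside setUC. Qed.

Lemma outside_add A B u : outside (u |: A) B = outside A B :\ u.
Proof. by rewrite /outside -setUA setCU setIC setDE. Qed.

(** Breaker owns all the pairs inside [S]. *)
Definition sealed K S := forall x y, x \in S -> y \in S -> x != y -> [set x; y] \in K.

(** An edge that Breaker may claim in answer to a join to [A]: it is either inside
    [A] or incident with an outside vertex, so it is not an edge of Maker. *)
Definition answer K A B e :=
  [/\ e \notin K, e \in edges n & e \subset A \/ exists2 w, w \in outside A B & w \in e].

Definition answers K A B D := forall e, e \in D -> answer K A B e.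

Lemma crossing_answer K A B S e : S \subset A :|: B ->
  crossing (outside A B) S e -> e \notin K -> answer K A B e.
Proof.
move=> sS [w [x [wU xS ->]]] eK; split=> //.
  rewrite inE cards2; suff -> : w != x by [].
  by apply: contraTneq wU => ->; rewrite inE negbK (subsetP sS).
by right; exists w; rewrite ?set21.
Qed.

(** When [u] joins [A], Breaker seals [A] by claiming the free edges from [u] to
    [A], then lowers the volumes of [B] and of [A] by [r1] and [r2]. *)
Lemma join_answer A B K u hA hB VA VB r1 r2 :
  u \in outside A B -> sealed K A ->
  water_level (outside A B) (open_degree K A) hA VA ->
  water_level (outside A B) (open_degree K B) hB VB ->
  exists D, [/\ answers K (u |: A) B D, #|D| <= open_degree K A u + r1 + r2,
    sealed (K :|: D) (u |: A),
    fits (outside (u |: A) B) (open_degree (K :|: D) (u |: A))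
      (VA - hA + #|outside (u |: A) B| - r2) &
    fits (outside (u |: A) B) (open_degree (K :|: D) B) (VB - hB - r1)].
Proof.
move=> uU sealA wA wB.
have uA : u \notin A by apply: contraL uU => uA; rewrite !inE uA.
(* [D0] seals [A], [D1] lowers the volume of [B], and [D2] that of [A]. *)
pose D0 := [set [set u; x] | x in [set x in A | [set u; x] \notin K]].
have [D1 [D1K cD1 fB]] : exists D, [/\ forall e, e \in D ->
    crossing (outside (u |: A) B) B e /\ e \notin K :|: D0, #|D| <= r1 &
    fits (outside (u |: A) B) (open_degree (K :|: D0 :|: D) B) (VB - hB - r1)].
  apply: claim_many; rewrite outside_add.
  apply: fits_le (fits_remove uU wB) => // w _; exact: open_degree_anti (subsetUl _ _).
have [D2 [D2K cD2 fA]] : exists D, [/\ forall e, e \in D ->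
    crossing (outside (u |: A) B) (u |: A) e /\ e \notin K :|: D0 :|: D1, #|D| <= r2 &
    fits (outside (u |: A) B) (open_degree (K :|: D0 :|: D1 :|: D) (u |: A))
      (VA - hA + #|outside (u |: A) B| - r2)].
  apply: claim_many; have := fits_remove uU wA; rewrite -outside_add.
  apply: fits_add1 => w _; apply: leq_trans (open_degree_add _ _ _ _) _.
  by rewrite ltnS; apply: open_degree_anti; rewrite -setUA subsetUl.
exists (D0 :|: D1 :|: D2); rewrite !setUA; split=> //.
- move=> e; rewrite 2!in_setU => /orP[/orP[|/D1K[]]|/D2K[]].
  + case/imsetP=> x; rewrite inE => /andP[xA eK] ->; split=> //.
      rewrite inE cards2; suff -> : u != x by [].
      by apply: contraNneq uA => ->.
    left; apply/subsetP=> y; rewrite !inE => /orP[->//|/eqP->].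
    by rewrite xA orbT.
  + move=> ce; rewrite in_setU negb_or => /andP[eK _].
    by apply: crossing_answer ce eK; apply: subsetUr.
  + move=> ce; rewrite 2!in_setU !negb_or => /andP[/andP[eK _] _].
    by apply: crossing_answer ce eK; apply: subsetUl.
- apply: leq_trans (leq_card_setU _ _) _; rewrite leq_add //.
  apply: leq_trans (leq_card_setU _ _) _; rewrite leq_add //.
  exact: leq_imset_card.
- move=> x y; rewrite !inE.
  have new z : z \in A -> [set u; z] \in K :|: D0.
    move=> zA; rewrite inE; case: (boolP ([set u; z] \in K)) => //= zK.
    by apply/imsetP; exists z; rewrite // inE zA.
  case/orP=> [/eqP->|xA] /orP[/eqP->|yA] nxy.
  + by rewrite eqxx in nxy.
  + by have := new y yA; rewrite !inE => /orP[->|->]; rewrite ?orbT.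
  + by rewrite setUC; have := new x xA; rewrite !inE => /orP[->|->]; rewrite ?orbT.
  + by rewrite (sealA x y).
- apply: fits_le fB => // w _; exact: open_degree_anti (subsetUl _ _).
Qed.

Lemma open_degree_join_le A K K' u c w : K \subset K' ->
  open_degree K A w <= c -> open_degree K' (u |: A) w <= c.+1.
Proof.
move=> sK dw; apply: leq_trans (open_degree_add _ _ _ _) _.
by rewrite ltnS; apply: leq_trans (open_degree_anti _ _ sK) dw.
Qed.

(** * The invariant *)

Section Bias.
Variables (F : realFieldType) (b : nat).

(** The endgame in which Breaker cuts [B] off the outside vertices: [A] is capped
    by [c] and [B] has the volume [V]. *)
Definition cutting K A B := exists c V,
  [/\ 0 < c, forall w, w \in outside A B -> open_degree K A w <= c,
      fits (outside A B) (open_degree K B) V & cut_budget b #|outside A B| c V].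

(** The opening: at most half of the vertices have joined. *)
Definition opening K A B := exists VA VB,
  [/\ fits (outside A B) (open_degree K A) VA, fits (outside A B) (open_degree K B) VB,
      n <= 2 * #|outside A B| &
      ((VA + VB)%:R <= opening_bound n%:R #|outside A B|%:R :> F)%R].

(** The numerical part of the invariant. *)
Definition safe K A B := opening K A B \/ (cutting K A B \/ cutting K B A).

Lemma opening_sym K A B : opening K A B -> opening K B A.
Proof. by case=> VA [VB [fA fB h1 h2]]; exists VB, VA; rewrite outsideC addnC. Qed.

Lemma safe_sym K A B : safe K A B -> safe K B A.
Proof. by rewrite /safe => -[/opening_sym|[]]; auto. Qed.

Lemma cutting_mono K K' A B : K \subset K' -> cutting K A B -> cutting K' A B.
Proof.
move=> sK [c [V [c0 cA fB kl]]]; exists c, V; split=> // [w wU|].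
  exact: leq_trans (open_degree_anti _ _ sK) (cA w wU).
by apply: fits_le fB => // w _; apply: open_degree_anti.
Qed.

Lemma safe_mono K K' A B : K \subset K' -> safe K A B -> safe K' A B.
Proof.
move=> sK [[VA [VB [fA fB h1 h2]]]|[k|k]].
- by left; exists VA, VB; split=> //; [apply: fits_le fA|apply: fits_le fB] => // w _;
    apply: open_degree_anti.
- by right; left; apply: cutting_mono k.
- by right; right; apply: cutting_mono k.
Qed.

Lemma outside_gt0 A B u : u \in outside A B -> 0 < #|outside A B|.
Proof. by move=> uU; apply/card_gt0P; exists u. Qed.

Lemma card_outside_add A B u : u \in outside A B ->
  #|outside (u |: A) B| = #|outside A B|.-1.
Proof. by move=> uU; rewrite outside_add [in RHS](cardsD1 u) uU. Qed.

Lemma cutting_join_cap A B K u : u \in outside A B -> 0 < open_degree K B u ->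
  sealed K A -> cutting K A B ->
  exists D, [/\ answers K (u |: A) B D, #|D| <= b, sealed (K :|: D) (u |: A) &
    cutting (K :|: D) (u |: A) B].
Proof.
move=> uU du sealA [c [V [c0 cA fB kl]]].
have [lt_cb kl'] := cut_budget_join_cap (outside_gt0 uU) (fits_gt0 uU du fB) kl.
have [hB wB] := fB.
have [D [aD cD sD _ fB']] :=
  join_answer (b - c) 0 uU sealA (water_level_const cA) wB.
exists D; split=> //.
  by apply: leq_trans cD _; have := cA u uU; lia.
exists c.+1, (V - (b - c)); split=> // [w||].
- rewrite outside_add inE => /andP[_ wU].
  by apply: open_degree_join_le (cA w wU); apply: subsetUl.
- by apply: fits_le fB' => //; lia.
- by rewrite card_outside_add.
Qed.

Lemma cutting_join_volume A B K u : 0 < b -> u \in outside A B ->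
  sealed K A -> cutting K B A ->
  exists D, [/\ answers K (u |: A) B D, #|D| <= b, sealed (K :|: D) (u |: A) &
    cutting (K :|: D) B (u |: A)].
Proof.
move=> b0 uU sealA [c [V [c0]]]; rewrite outsideC => cB [hA wA] kl.
have hV : #|outside A B| * hA <= V by apply: leq_trans wA.2; rewrite leq_addr.
have [lt_hb kl'] := cut_budget_join_volume (outside_gt0 uU) c0 b0 hV kl.
have [D [aD cD sD fA' _]] :=
  join_answer 0 (b - hA.+1) uU sealA wA (water_level_const cB).
exists D; split=> //.
  by apply: leq_trans cD _; have := wA.1 u uU; lia.
exists c, (V - hA + #|outside A B|.-1 - (b - hA.+1)); rewrite outsideC; split=> // [w||].
- rewrite outside_add inE => /andP[_ wU].
  by apply: leq_trans (open_degree_anti _ _ _) (cB w wU); apply: subsetUl.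
- by rewrite -(card_outside_add uU).
- by rewrite card_outside_add.
Qed.

Lemma safe_join A B K u : (200 * 100 <= n%:R :> F)%R ->
  47 * n < 100 * b + 100 -> 100 * b <= 47 * n -> 0 < b ->
  u \in outside A B -> 0 < open_degree K B u -> sealed K A -> safe K A B ->
  exists D, [/\ answers K (u |: A) B D, #|D| <= b, sealed (K :|: D) (u |: A) &
    safe (K :|: D) (u |: A) B].
Proof.
move=> n0 b1 b2 b0 uU du sealA gK.
have capcase : cutting K A B -> exists D, [/\ answers K (u |: A) B D, #|D| <= b,
   sealed (K :|: D) (u |: A) & safe (K :|: D) (u |: A) B].
  move=> k; have [D [aD cD sD kD]] := cutting_join_cap uU du sealA k.
  by exists D; split=> //; right; left.
have volcase : cutting K B A -> exists D, [/\ answers K (u |: A) B D, #|D| <= b,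
   sealed (K :|: D) (u |: A) & safe (K :|: D) (u |: A) B].
  move=> k; have [D [aD cD sD kD]] := cutting_join_volume b0 uU sealA k.
  by exists D; split=> //; right; right.
case: gK => [[VA0 [VB0 [[hA wA0] [hB wB0] hn hPhi]]]|[/capcase|/volcase]] //.
have [VA [wA /andP[hVA _] lVA]] := water_level_exact wA0.
have [VB [wB hVB lVB]] := water_level_exact wB0.
have {}hPhi : ((VA + VB)%:R <= opening_bound n%:R #|outside A B|%:R :> F)%R.
  by apply: le_trans hPhi; rewrite ler_nat leq_add.
(* The endgame starts as soon as one of its two inequalities holds. *)
case: (boolP (cut_budget b #|outside A B| hA.+1 VB)) => [k|kA].
  by apply: capcase; exists hA.+1, VB; split=> //; [exact: wA.1|exists hB].
case: (boolP (cut_budget b #|outside A B| hB.+1 VA)) => [k|kB].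
  by apply: volcase; exists hB.+1, VA; rewrite outsideC; split=> //; [exact: wB.1|exists hA].
have le_mn : #|outside A B| <= n by rewrite -[X in _ <= X](card_ord n) max_card.
have [lt_hb hn' hPhi'] :=
  opening_join_numbers n0 (outside_gt0 uU) le_mn hn b1 b2 hVA hVB hPhi kA kB.
set r := b - hA.+1 in hPhi'.
(* What is left after sealing [A] lowers the volume of [B] first. *)
have [D [aD cD sD fA' fB']] :=
  join_answer (minn r (VB - hB)) (r - minn r (VB - hB)) uU sealA wA wB.
exists D; split=> //.
  by apply: leq_trans cD _; have := wA.1 u uU; rewrite /r; clear - lt_hb; lia.
left; do 2 eexists; split; [exact: fA'|exact: fB'|by rewrite card_outside_add|].
rewrite card_outside_add //; apply: le_trans hPhi'; rewrite ler_nat.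
by clear; lia.
Qed.

End Bias.
End Board.

(** * The strategy *)

Section Strategy.
Variables (F : realFieldType) (n b : nat).
Hypotheses (n_large : (200 * 100 <= n%:R :> F)%R) (b_gt0 : 0 < b)
  (b_lower : 47 * n < 100 * b + 100) (b_upper : 100 * b <= 47 * n).
Implicit Types (M K D : {set {set 'I_n}}) (e A B S U : {set 'I_n}).

(** An edge between [A] and [B]. *)
Definition between A B e := exists x y, [/\ x \in A, y \in B & e = [set x; y]].

Lemma between_sym A B e : between A B e -> between B A e.
Proof. by case=> x [y [xA yB ->]]; exists y, x; rewrite setUC. Qed.

Lemma bipartite_no_odd_cycle M A B : [disjoint A & B] ->
  (forall e, e \in M -> between A B e) -> ~ exists2 F, @odd_cycles n F & F \subset M.
Proof.
move=> dAB bip [_ [c [Uc _ oc ->]] sM].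
apply: (odd_cycle_not_bipartite (A := A) Uc oc) => x xc.
have notAB z : z \in A -> z \in B -> False.
  by move=> zA; rewrite (disjointFr dAB zA).
have /bip[a [a' [aA aB eq_e]]] : [set x; next c x] \in M.
  by apply: (subsetP sM); apply: imset_f.
have : a \in [set x; next c x] by rewrite eq_e set21.
have : a' \in [set x; next c x] by rewrite eq_e set22.
have neq : a != a' by apply: contraTneq aB => <-; apply/negP/notAB.
have aB' : a' \notin A by apply/negP=> /notAB /(_ aB).
rewrite !inE => /orP[]/eqP eq1 /orP[]/eqP eq2.
- by rewrite eq1 eq2 eqxx in neq.
- by rewrite -eq2 -eq1 aA aB'.
- by rewrite -eq1 -eq2 aA (negbTE aB').
- by rewrite eq1 eq2 eqxx in neq.
Qed.

(** The full invariant, once Maker has claimed an edge: her graph [M] is bipartite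
    with sides [A] and [B], and Breaker owns all the pairs inside the sides. *)
Definition position M K A B :=
  [/\ [disjoint A & B], forall e, e \in M -> between A B e, sealed K A, sealed K B &
      safe F b K A B].

Lemma position_sym M K A B : position M K A B -> position M K B A.
Proof.
case=> dAB bip sA sB gK; split=> //; first by rewrite disjoint_sym.
  by move=> e /bip/between_sym.
exact: safe_sym.
Qed.

Lemma sealed_mono K K' S : K \subset K' -> sealed K S -> sealed K' S.
Proof. by move=> sK sS x y xS yS nxy; apply: (subsetP sK); apply: sS. Qed.

(** Breaker has an answer to the edge [e] that maintains the invariant. *)
Definition reply M K e := exists D,
  [/\ D \subset edges n :\: (M :|: K) :\ e, #|D| <= b &
    forall K', K :|: D \subset K' -> exists A B, position (e |: M) K' A B].

(** An edge of Maker that meets [A] at [x]: its other end [y] is either in [B], and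
    nothing changes, or outside, and it joins [B]. *)
Lemma reply_edge_in_A M K A B x y : position M K A B -> x \in A -> x != y ->
  [set x; y] \notin K -> reply M K [set x; y].
Proof.
case=> dAB bip sA sB gK xA nxy eK.
have yA : y \notin A by apply: contra eK => yA; apply: sA.
have [yB|yB] := boolP (y \in B).
  exists set0; split=> [||K']; rewrite ?sub0set ?cards0 // setU0 => sK.
  exists A, B; split=> //; try exact: sealed_mono sK _; last exact: safe_mono gK.
  by move=> e; rewrite !inE => /orP[/eqP ->|/bip//]; exists x, y.
have yU : y \in outside B A by rewrite !inE negb_or yB.
have dy : 0 < open_degree K A y.
  by apply/card_gt0P; exists x; rewrite !inE xA setUC.
have [D [aD cD sD gD]] :=
  safe_join n_large b_lower b_upper b_gt0 yU dy sB (safe_sym gK).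
(* Neither Maker's edges nor her new one can be among the edges of [D]. *)
have notD e : between A (y |: B) e -> e \notin D.
  case=> a [a' [aA aB' ->]]; apply/negP=> /aD[_ _ [/subsetP sub|[w]]].
    have := sub a (set21 _ _); rewrite !inE (disjointFr dAB aA) orbF => /eqP eq_ay.
    by rewrite -eq_ay aA in yA.
  by rewrite inE => /negP wU; rewrite !inE => /orP[]/eqP eq_w; apply: wU;
    rewrite inE eq_w ?aA ?aB' ?orbT.
exists D; split=> // [|K' sK].
  apply/subsetP=> e eD; have [eK' ee _] := aD e eD.
  rewrite in_setD1 in_setD in_setU ee negb_or eK' !andbT; apply/andP; split.
    by apply: contraTneq eD => ->; apply: notD; exists x, y; rewrite setU11.
  apply: contraL eD => /bip[a [a' [aA aB ->]]].
  by apply: notD; exists a, a'; rewrite inE aB orbT.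
exists A, (y |: B); split=> //.
- by rewrite -setI_eq0 setIUr setU_eq0 !setI_eq0 dAB andbT disjoint_sym disjoints1.
- move=> e; rewrite !inE => /orP[/eqP ->|/bip[a [a' [aA aB ->]]]].
    by exists x, y; rewrite setU11.
  by exists a, a'; rewrite inE aB orbT.
- by apply: sealed_mono sA; apply: subset_trans (subsetUl _ _) sK.
- exact: sealed_mono sK sD.
- by apply: safe_sym; apply: safe_mono sK gD.
Qed.

Lemma reply_first_edge K x y : x != y -> reply set0 K [set x; y].
Proof.
move=> nxy; exists set0; split=> [||K' _]; rewrite ?sub0set ?cards0 //.
have sealed1 z : sealed K' [set z].
  by move=> u v; rewrite !inE => /eqP-> /eqP->; rewrite eqxx.
have fits1 z : fits (outside [set x] [set y]) (open_degree K' [set z])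
    #|outside [set x] [set y]|.
  exists 0; split=> [u _|].
    by rewrite -(cards1 z); apply/subset_leq_card/subsetP=> v; rewrite inE => /andP[].
  by rewrite muln0; apply/subset_leq_card/subsetP=> v; rewrite inE => /andP[].
have cU : #|outside [set x] [set y]| = n - 2.
  by rewrite cardsCs setCK cards2 nxy card_ord.
exists [set x], [set y]; split=> //.
- by rewrite disjoints1 inE.
- by move=> e; rewrite !inE orbF => /eqP ->; exists x, y; rewrite !inE.
left; exists #|outside [set x] [set y]|, #|outside [set x] [set y]|.
have n4 : 4 <= n.
  by rewrite -(ler_nat F); apply: le_trans n_large; rewrite -natrM ler_nat.
split=> //; rewrite cU; first by clear - n4; lia.
by rewrite natrD natrB ?(leq_trans _ n4) //; apply: opening_bound_start.
Qed.

Lemma breaker_wins_odd_cycles : breaker_wins (@odd_cycles n) b.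
Proof.
apply: (invariant_breaker_wins
  (I := fun M K => M = set0 \/ exists A B, position M K A B)); first by left.
move=> M K e IM ee eM eK et.
suff rep : reply M K e.
  split; last by have [D [sD cD hD]] := rep; exists D; split=> // K' /hD; right.
  have [D [_ _ /(_ _ (subxx _))[A [B [dAB bip _ _ _]]]]] := rep.
  exact: bipartite_no_odd_cycle dAB bip.
have [x [y [nxy def_e]]] : exists x y, x != y /\ e = [set x; y].
  by apply/cards2P; move: ee; rewrite inE.
have [M0|M0] := eqVneq M set0; first by rewrite M0 def_e; apply: reply_first_edge.
case: IM => [eqM|[A [B pos]]]; first by rewrite eqM eqxx in M0.
move: et; rewrite /touches (negbTE M0) /= => /existsP[f /andP[fM /set0Pn[z]]].
rewrite inE => /andP[ze zf].
have [w nzw {}def_e] : exists2 w, z != w & e = [set z; w].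
  move: ze; rewrite def_e !inE => /orP[]/eqP->; first by exists y.
  by exists x; rewrite 1?eq_sym // setUC.
rewrite def_e in eK *.
have [_ bip _ _ _] := pos; have [a [a' [aA aB def_f]]] := bip f fM.
move: zf; rewrite def_f !inE => /orP[]/eqP eq_z; rewrite eq_z in nzw eK *.
  exact: reply_edge_in_A pos aA nzw eK.
exact: reply_edge_in_A (position_sym pos) aB nzw eK.
Qed.

End Strategy.

Theorem theorem1p2 :
  exists N : nat, forall n : nat, (N <= n)%N ->
    exists t : nat, is_threshold_bias (@odd_cycles n) t /\
      (t%:R <= 0.47%Q * n%:R :> rat)%R.
Proof.
exists (200 * 100) => n n_large.
have n100 : 100 <= n by apply: leq_trans n_large; apply: leq_pmull.
have n_largeR : (200 * 100 <= n%:R :> rat)%R by rewrite -natrM ler_nat.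
have [t t_thr le_t] : exists2 t, is_threshold_bias (@odd_cycles n) t & t <= 47 * n %/ 100.
  apply: threshold_exists; apply: (breaker_wins_odd_cycles n_largeR); clear n_large n_largeR.
  - by rewrite divn_gt0; lia.
  - by rewrite {1}(divn_eq (47 * n) 100) mulnC ltn_add2l ltn_mod.
  - by rewrite mulnC leq_trunc_div.
clear n_large n_largeR n100.
exists t; split; first exact: t_thr.
have -> : 0.47%Q = (47 / 100)%R by apply/eqP.
have : ((t * 100)%:R <= (47 * n)%:R :> rat)%R.
  by rewrite ler_nat; apply: leq_trans (leq_trunc_div _ 100); rewrite leq_mul2r le_t.
by rewrite !natrM mulrAC -ler_pdivlMr.
Qed.
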